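(* Assume the axiom of choice. Let $\mathcal A$ be an implicative algebra with separator $\mathscr S$ and let $M\subseteq\mathscr S$ be a (nonempty) algebraic subset. The following are equivalent: (i) $M$ is compact; (ii) the canonical functor $\mathcal U:(\mathbf{Asm}_M)_{\mathrm{reg/lex}}\to\mathbf{Asm}_{\mathcal A}$ is full.
   Context: An implicative structure is a complete lattice $(\mathcal A,\preccurlyeq)$ with a binary operation $\to$, antitone in the first and monotone in the second argument, such that $a\to\bigwedge B=\bigwedge_{b\in B}(a\to b)$ for all $a\in\mathcal A$, $B\subseteq\mathcal A$. An implicative algebra is an implicative structure with a separator $\mathscr S\subseteq\mathcal A$: an upward closed subset containing $\bigwedge_{a,b}(a\to(b\to a))$ and $\bigwedge_{a,b,c}((a\to(b\to c))\to((a\to b)\to(a\to c)))$ and closed under modus ponens ($a\in\mathscr S$ and $(a\to b)\in\mathscr S$ imply $b\in\mathscr S$). Put $a\sqcap b:=\bigwedge_{c\in\mathcal A}((a\to(b\to c))\to c)$ and, for $U\subseteq\mathcal A$, $\mathrm{ex}(U):=\bigwedge_{c\in\mathcal A}\big((\bigwedge_{u\in U}(u\to c))\to c\big)$. For families $u,v:X\to\mathcal A$ write $u\sqsubseteq_X v$ if $\bigwedge_{x\in X}(u_x\to v_x)\in\mathscr S$. An assembly is a set $X$ with a map $\mathsf E_X:X\to\mathscr S$; a morphism of assemblies $X\to Y$ is a map $f$ which is tracked, i.e. $\bigwedge_{x\in X}(\mathsf E_X(x)\to\mathsf E_Y(f(x)))\in\mathscr S$. These form the category $\mathbf{Asm}_{\mathcal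 A}$ (a quasitopos, hence regular). For $M\subseteq\mathscr S$, $\mathbf{Asm}_M$ is the full subcategory on assemblies with $\mathsf E_X$ valued in $M$. $M$ is algebraic if it is closed under $\sqcap$; then $\mathbf{Asm}_M$ is closed under finite limits in $\mathbf{Asm}_{\mathcal A}$. The image of $f:X\to Y$ in $\mathbf{Asm}_{\mathcal A}$ is the assembly $\mathrm{Im}(f)$ with carrier $\{[x]\mid x\in X\}$, $[x]=f^{-1}(f(x))$, and $\mathsf E_{\mathrm{Im}(f)}([x])=\mathrm{ex}\{\mathsf E_X(x')\mid x'\in[x]\}$; $f=\iota_f\circ\bar f$ with $\bar f(x)=[x]$ regular epi and $\iota_f([x])=f(x)$ mono. The regular completion $\mathbb C_{\mathrm{reg/lex}}$ of a category $\mathbb C$ with finite limits has as objects the morphisms $f:X\to Y$ of $\mathbb C$; a morphism from $(f:X\to Y)$ to $(f':X'\to Y')$ is an equivalence class $[l]$ of morphisms $l:X\to X'$ such that $f'\circ l$ coequalises the kernel pair of $f$, where $[l_1]=[l_2]$ iff $f'\circ l_1=f'\circ l_2$. The functor $\mathcal U:(\mathbf{Asm}_M)_{\mathrm{reg/lex}}\to\mathbf{Asm}_{\mathcal A}$ sends $f$ to $\mathrm{Im}(f)$ and $[l]$ to the unique $\tilde l:\mathrm{Im}(f)\to\mathrm{Im}(f')$ with $\tilde l\circ\bar f=\overline{f'}\circ l$. $\mathfrak P_\bullet(M)$ is the set of nonempty subsets of $M$. A valuation is a map $\nu:X\to\mathfrak P_\bullet(M)$; $\mathrm{ex}\,\nu$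 denotes the family $(\mathrm{ex}(\nu(x)))_{x\in X}$. $M\subseteq\mathscr S$ is compact if for every set $X$, every family $u:X\to M$ and every valuation $\nu:X\to\mathfrak P_\bullet(M)$ with $u\sqsubseteq_X\mathrm{ex}\,\nu$, there is a family $b:X\to M$ with $b_x\in\nu(x)$ for all $x\in X$ and $u\sqsubseteq_X b\sqsubseteq_X\mathrm{ex}\,\nu$. *)

(* Defs.v *)
From mathcomp Require Import all_boot all_order.
From mathcomp Require Import boolp classical_sets.

Set Implicit Arguments.
Unset Strict Implicit.
Unset Printing Implicit Defensive.

Import Order.Theory.
Local Open Scope classical_set_scope.
Local Open Scope order_scope.

Lemma sval_inj (T : Type) (P : T -> Prop) (a b : {x | P x}) :
  sval a = sval b -> a = b.
Proof.
by case: a b => [x p] [y q] /= e; subst y; rewrite (Prop_irrelevance p q).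
Qed.

Record category := Category {
  obj :> Type;
  hom : obj -> obj -> Type;
  idc : forall X, hom X X;
  comp : forall X Y Z, hom Y Z -> hom X Y -> hom X Z;
  comp1f : forall X Y (f : hom X Y), comp (idc Y) f = f;
  compf1 : forall X Y (f : hom X Y), comp f (idc X) = f;
  compA : forall W X Y Z (h : hom Y Z) (g : hom X Y) (f : hom W X),
    comp h (comp g f) = comp (comp h g) f }.

Arguments idc {c} X.
Arguments comp {c X Y Z} g f.
Notation "g \oc f" := (comp g f) (at level 50, left associativity).

Record functor (C D : category) := Functor {
  fobj :> C -> D;
  fmap : forall X Y : C, hom X Y -> hom (fobj X) (fobj Y);
  fmap1 : forall X : C, fmap (idc X) = idc (fobj X);
  fmapM : forall (X Y Z : C) (g : hom Y Z) (f : hom X Y),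
    fmap (g \oc f) = fmap g \oc fmap f }.

Arguments fmap {C D} F {X Y} f : rename.

Definition full (C D : category) (F : functor C D) : Prop :=
  forall (X Y : C) (h : hom (F X) (F Y)), exists g : hom X Y, fmap F g = h.

Definition full_subcategory (C : category) (P : C -> Prop) : category :=
  @Category {X : C | P X} (fun X Y => hom (sval X) (sval Y))
    (fun X => idc (sval X)) (fun _ _ _ g f => g \oc f)
    (fun _ _ => @comp1f C _ _) (fun _ _ => @compf1 C _ _)
    (fun _ _ _ _ => @compA C _ _ _ _).

Section FiniteLimits.
Variable C : category.

Definition is_terminal (T : C) : Prop :=
  forall X : C, exists! f : hom X T, True.

Definition is_pullback (X Y Z P : C) (f : hom X Z) (g : hom Y Z)
    (p : hom P X) (q : hom P Y) : Prop :=
  f \oc p = g \oc q /\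
  forall (W : C) (h : hom W X) (k : hom W Y), f \oc h = g \oc k ->
    exists! m : hom W P, p \oc m = h /\ q \oc m = k.

Definition is_kernel_pair (X Y K : C) (f : hom X Y) (p1 p2 : hom K X) : Prop :=
  is_pullback f f p1 p2.

(* Terminal object and pullbacks generate all finite limits. *)
Definition finitely_complete : Prop :=
  (exists T : C, is_terminal T) /\
  (forall (X Y Z : C) (f : hom X Z) (g : hom Y Z),
     exists (P : C) (p : hom P X) (q : hom P Y), is_pullback f g p q).

End FiniteLimits.

Record arrow_of (C : category) := ArrowOf {
  adom : C;
  acod : C;
  amap :> hom adom acod }.

Section RegLex.
Variables (C : category) (lexC : finitely_complete C).

(* Kernel pairs exist and are unique up to isomorphism, so quantifying over
   all of them amounts to fixing one. *)
Definition reg_premor (f f' : arrow_of C) : set (hom (adom f) (adom f')) :=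
  [set l | forall (K : C) (p1 p2 : hom K (adom f)), is_kernel_pair f p1 p2 ->
     (f' \oc l) \oc p1 = (f' \oc l) \oc p2].

Definition reg_eq (f f' : arrow_of C) (l1 l2 : hom (adom f) (adom f')) : Prop :=
  f' \oc l1 = f' \oc l2.

Definition reg_class (f f' : arrow_of C) (l : hom (adom f) (adom f')) :
    set (hom (adom f) (adom f')) :=
  [set l' | reg_premor l' /\ reg_eq l l'].

Definition reg_hom (f f' : arrow_of C) : Type :=
  {c : set (hom (adom f) (adom f')) | exists2 l, reg_premor l & c = reg_class l}.

Definition reg_mk (f f' : arrow_of C) (l : hom (adom f) (adom f'))
    (hl : reg_premor l) : reg_hom f f' :=
  exist _ (reg_class l) (ex_intro2 _ _ l hl erefl).

Definition reg_rep (f f' : arrow_of C) (c : reg_hom f f') :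
    hom (adom f) (adom f') := s2val (cid2 (svalP c)).

Lemma reg_repP (f f' : arrow_of C) (c : reg_hom f f') : reg_premor (reg_rep c).
Proof. exact: (s2valP (cid2 (svalP c))). Qed.

Lemma reg_repE (f f' : arrow_of C) (c : reg_hom f f') :
  c = reg_mk (reg_repP c).
Proof.
by apply: sval_inj; exact: (s2valP' (cid2 (svalP c))).
Qed.

Lemma reg_mk_eq (f f' : arrow_of C) (l1 l2 : hom (adom f) (adom f'))
    (h1 : reg_premor l1) (h2 : reg_premor l2) :
  reg_mk h1 = reg_mk h2 <-> reg_eq l1 l2.
Proof.
split=> [/(congr1 sval)/= e|e].
  by have: reg_class l2 l2 by []; rewrite -e => -[].
apply: sval_inj; apply/seteqP; split=> l' [hl' e']; split=> //.
  by rewrite /reg_eq -e.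
by rewrite /reg_eq e.
Qed.

Lemma reg_rep_mk (f f' : arrow_of C) (l : hom (adom f) (adom f'))
  (hl : reg_premor l) : reg_eq (reg_rep (reg_mk hl)) l.
Proof. by apply/(reg_mk_eq (reg_repP _) hl); rewrite -reg_repE. Qed.

Lemma reg_premor1 (f : arrow_of C) : reg_premor (f := f) (idc (adom f)).
Proof. by move=> K p1 p2 [+ _]; rewrite compf1. Qed.

Lemma reg_premor_coeq (f f' : arrow_of C) (l : hom (adom f) (adom f')) :
  reg_premor l -> forall (W : C) (h k : hom W (adom f)),
  f \oc h = f \oc k -> f' \oc (l \oc h) = f' \oc (l \oc k).
Proof.
move=> hl W h k e.
have [K [p1 [p2 kp]]] := lexC.2 _ _ _ f f.
have [m [[<- <-] _]] := kp.2 W h k e.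
by rewrite !compA (hl _ _ _ kp).
Qed.

Lemma reg_premorM (f f' f'' : arrow_of C) (l' : hom (adom f') (adom f''))
    (l : hom (adom f) (adom f')) :
  reg_premor l' -> reg_premor l -> reg_premor (f := f) (f' := f'') (l' \oc l).
Proof.
move=> hl' hl K p1 p2 kp.
rewrite -!compA; apply: (reg_premor_coeq hl').
by rewrite !compA; exact: hl.
Qed.

Lemma reg_eqM (f f' f'' : arrow_of C) (k1 k2 : hom (adom f') (adom f''))
    (l1 l2 : hom (adom f) (adom f')) :
  reg_premor k1 -> reg_eq k1 k2 -> reg_eq l1 l2 ->
  reg_eq (f := f) (f' := f'') (k1 \oc l1) (k2 \oc l2).
Proof.
move=> h1 ek el; rewrite /reg_eq (reg_premor_coeq h1 el).
by rewrite !compA ek.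
Qed.

Definition reg_id (f : arrow_of C) : reg_hom f f := reg_mk (@reg_premor1 f).

Definition reg_comp (f f' f'' : arrow_of C) (d : reg_hom f' f'')
    (c : reg_hom f f') : reg_hom f f'' :=
  reg_mk (reg_premorM (reg_repP d) (reg_repP c)).

Lemma reg_comp_mk (f f' f'' : arrow_of C) (l' : hom (adom f') (adom f''))
    (l : hom (adom f) (adom f')) (hl' : reg_premor l') (hl : reg_premor l) :
  reg_comp (reg_mk hl') (reg_mk hl) = reg_mk (reg_premorM hl' hl).
Proof.
apply/reg_mk_eq/reg_eqM; [exact: reg_repP|exact: reg_rep_mk|].
exact: reg_rep_mk.
Qed.

Lemma reg_comp1f (f f' : arrow_of C) (c : reg_hom f f') :
  reg_comp (reg_id f') c = c.
Proof.
by rewrite (reg_repE c) reg_comp_mk; apply/reg_mk_eq; rewrite comp1f.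
Qed.

Lemma reg_compf1 (f f' : arrow_of C) (c : reg_hom f f') :
  reg_comp c (reg_id f) = c.
Proof.
by rewrite (reg_repE c) reg_comp_mk; apply/reg_mk_eq; rewrite compf1.
Qed.

Lemma reg_compA (e f g h : arrow_of C) (c : reg_hom g h) (b : reg_hom f g)
    (a : reg_hom e f) :
  reg_comp c (reg_comp b a) = reg_comp (reg_comp c b) a.
Proof.
rewrite (reg_repE a) (reg_repE b) (reg_repE c) !reg_comp_mk.
by apply/reg_mk_eq; rewrite compA.
Qed.

Definition reg_lex : category :=
  Category reg_comp1f reg_compf1 reg_compA.

End RegLex.

Record implicativeStructure (d : Order.disp_t) := ImplicativeStructure {
  imp_poset :> porderType d;
  inf : set imp_poset -> imp_poset;
  infP : forall B, infimums B (inf B);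
  sup : set imp_poset -> imp_poset;
  supP : forall B, supremums B (sup B);
  imp : imp_poset -> imp_poset -> imp_poset;
  imp_mono : forall a a' b b', a' <= a -> b <= b' -> imp a b <= imp a' b';
  imp_inf : forall a B, imp a (inf B) = inf [set imp a b | b in B] }.

Arguments inf {d A} _ : rename.
Arguments sup {d A} _ : rename.
Arguments imp {d A} _ _ : rename.
Notation "a ~~> b" := (imp a b) (at level 55, right associativity).

Definition meet d (A : implicativeStructure d) (I : Type) (F : I -> A) : A :=
  inf (range F).

Record implicativeAlgebra (d : Order.disp_t) := ImplicativeAlgebra {
  imp_struct :> implicativeStructure d;
  separator : set imp_struct;
  sep_up : forall a b : imp_struct, a <= b -> separator a -> separator b;
  sep_K : separator (inf [set x | exists a b, x = a ~~> b ~~> a]);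
  sep_S : separator (inf [set x | exists a b c,
    x = (a ~~> b ~~> c) ~~> (a ~~> b) ~~> a ~~> c]);
  sep_mp : forall a b : imp_struct,
    separator a -> separator (a ~~> b) -> separator b }.

Arguments separator {d} A : rename.

Section ImplicativeAlgebra.
Context (d : Order.disp_t) (A : implicativeAlgebra d).
Local Notation S := (separator A).

(* The second-order encodings of the conjunction (written as a square cap) and
   of the existential quantifier. *)
Definition conj (a b : A) : A := meet (fun c : A => (a ~~> b ~~> c) ~~> c).

Definition ex (U : set A) : A :=
  meet (fun c : A => inf [set u ~~> c | u in U] ~~> c).

Definition entails (X : Type) (u v : X -> A) : Prop :=
  S (meet (fun x => u x ~~> v x)).

Definition algebraic (M : set A) : Prop :=
  forall a b, M a -> M b -> M (conj a b).

Definition compact (M : set A) : Prop :=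
  forall (X : Type) (u : X -> A) (nu : X -> set A),
    (forall x, M (u x)) ->
    (forall x, nu x !=set0 /\ nu x `<=` M) ->
    entails u (fun x => ex (nu x)) ->
    exists b : X -> A,
      [/\ forall x, M (b x), forall x, nu x (b x), entails u b
        & entails b (fun x => ex (nu x))].

Lemma inf_le (B : set A) b : B b -> inf B <= b.
Proof. by case: (infP B) => h _; exact: h. Qed.

Lemma le_inf (B : set A) a : (forall b, B b -> a <= b) -> a <= inf B.
Proof. by case: (infP B) => _ h ha; exact: h. Qed.

Lemma meet_le (I : Type) (F : I -> A) i : meet F <= F i.
Proof. by apply: inf_le; exists i. Qed.

Lemma le_meet (I : Type) (F : I -> A) a : (forall i, a <= F i) -> a <= meet F.
Proof. by move=> h; apply: le_inf => _ [i _ <-]. Qed.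

Lemma imp_meet (I : Type) (F : I -> A) a :
  a ~~> meet F = meet (fun i => a ~~> F i).
Proof.
apply/le_anti/andP; split.
  by apply: le_meet => i; apply: imp_mono => //; exact: meet_le.
by rewrite /meet imp_inf; apply: le_inf => _ [_ [i _ <-] <-]; exact: meet_le.
Qed.

Section Valid.
Variable I : Type.
Implicit Types u v p q r : I -> A.

Definition valid u : Prop := S (meet u).

Lemma valid_le u v : (forall i, u i <= v i) -> valid u -> valid v.
Proof.
move=> h; apply: sep_up; apply: le_meet => i.
exact: le_trans (meet_le u i) (h i).
Qed.

Lemma valid_mp u v : valid (fun i => u i ~~> v i) -> valid u -> valid v.
Proof.
move=> huv hu; apply: (sep_mp hu); apply: sep_up huv.
rewrite imp_meet; apply: le_meet => i; apply: le_trans (meet_le _ i) _.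
by apply: imp_mono => //; exact: meet_le.
Qed.

Lemma validK p q : valid (fun i => p i ~~> q i ~~> p i).
Proof.
apply: sep_up (sep_K A); apply: le_meet => i; apply: inf_le.
by exists (p i), (q i).
Qed.

Lemma validS p q r :
  valid (fun i => (p i ~~> q i ~~> r i) ~~> (p i ~~> q i) ~~> p i ~~> r i).
Proof.
apply: sep_up (sep_S A); apply: le_meet => i; apply: inf_le.
by exists (p i), (q i), (r i).
Qed.

Lemma valid_weak p q : valid q -> valid (fun i => p i ~~> q i).
Proof. exact/valid_mp/validK. Qed.

Lemma valid_ap p q r : valid (fun i => p i ~~> q i ~~> r i) ->
  valid (fun i => p i ~~> q i) -> valid (fun i => p i ~~> r i).
Proof. by move=> h; apply: valid_mp; exact: valid_mp (validS p q r) h. Qed.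

Lemma valid_trans p q r : valid (fun i => p i ~~> q i) ->
  valid (fun i => q i ~~> r i) -> valid (fun i => p i ~~> r i).
Proof. by move=> h1 h2; apply: valid_ap h1; exact: valid_weak. Qed.

Lemma valid_refl p : valid (fun i => p i ~~> p i).
Proof. exact: (valid_ap (validK p (fun i => p i ~~> p i)) (validK p p)). Qed.

Lemma valid_swap p q r : valid (fun i => p i ~~> q i ~~> r i) ->
  valid (fun i => q i ~~> p i ~~> r i).
Proof.
move=> h; apply: valid_ap (validK q p).
apply: valid_trans (valid_weak q h) (validS p q r).
Qed.

Lemma valid_app p q : valid (fun i => p i ~~> (p i ~~> q i) ~~> q i).
Proof. exact/valid_swap/valid_refl. Qed.

Lemma validB p q r :
  valid (fun i => (p i ~~> q i) ~~> (q i ~~> r i) ~~> p i ~~> r i).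
Proof. exact/valid_swap/(valid_trans (validK _ p))/validS. Qed.

End Valid.

Lemma valid_reindex (I J : Type) (f : J -> I) (u : I -> A) :
  valid u -> valid (fun j => u (f j)).
Proof. by apply: sep_up; apply: le_meet => j; exact: meet_le. Qed.

Lemma valid_gen (I : Type) (J : I -> Type) (u : I -> A)
    (v : forall i, J i -> A) :
  valid (fun p : {i & J i} => u (tag p) ~~> v (tag p) (tagged p)) ->
  valid (fun i => u i ~~> meet (v i)).
Proof.
apply: sep_up; apply: le_meet => i; rewrite imp_meet; apply: le_meet => j.
exact: (meet_le _ (existT _ i j)).
Qed.

Lemma sep_valid (a : A) (I : Type) : S a -> valid (fun _ : I => a).
Proof. by apply: sep_up; exact: le_meet. Qed.

Lemma valid_sep (I : Type) (u : I -> A) i : valid u -> S (u i).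
Proof. by apply: sep_up; exact: meet_le. Qed.

Lemma conj_le (a b c : A) : conj a b <= (a ~~> b ~~> c) ~~> c.
Proof. exact: (meet_le (fun c => _ ~~> c) c). Qed.

Lemma valid_conj1 (I : Type) (p q : I -> A) :
  valid (fun i => conj (p i) (q i) ~~> p i).
Proof.
apply: (valid_le (u := fun i =>
  ((p i ~~> q i ~~> p i) ~~> p i) ~~> p i)) => [i|].
  by apply: imp_mono => //; exact: conj_le.
exact: valid_mp (valid_app _ _) (validK p q).
Qed.

Lemma valid_conj2 (I : Type) (p q : I -> A) :
  valid (fun i => conj (p i) (q i) ~~> q i).
Proof.
apply: (valid_le (u := fun i =>
  ((p i ~~> q i ~~> q i) ~~> q i) ~~> q i)) => [i|].
  by apply: imp_mono => //; exact: conj_le.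
by apply: valid_mp (valid_app _ _) _; apply: valid_weak; exact: valid_refl.
Qed.

Lemma valid_pair0 (I : Type) (r p q c : I -> A) :
  valid (fun i => r i ~~> p i) -> valid (fun i => r i ~~> q i) ->
  valid (fun i => r i ~~> (p i ~~> q i ~~> c i) ~~> c i).
Proof.
move=> hp hq; apply: valid_swap.
have h : valid (fun i => (p i ~~> q i ~~> c i) ~~> r i ~~> q i ~~> c i).
  by apply/valid_swap/(valid_trans hp); exact: valid_app.
apply: valid_trans h _.
exact: valid_ap (validS r q c) (valid_weak _ hq).
Qed.

Lemma valid_pair (I : Type) (r p q : I -> A) :
  valid (fun i => r i ~~> p i) -> valid (fun i => r i ~~> q i) ->
  valid (fun i => r i ~~> conj (p i) (q i)).
Proof.
move=> hp hq; apply: (@valid_gen I (fun=> A)) => /=.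
exact: (@valid_pair0 {i : I & A} (fun x => r (tag x)) (fun x => p (tag x))
  (fun x => q (tag x)) (fun x => tagged x)
  (valid_reindex (@tag I (fun=> A)) hp) (valid_reindex (@tag I (fun=> A)) hq)).
Qed.

Lemma ex_le (U : set A) c : ex U <= inf [set u ~~> c | u in U] ~~> c.
Proof. exact: (meet_le (fun c => _ ~~> c) c). Qed.

Lemma valid_ex_intro (I : Type) (U : I -> set A) (a : I -> A) :
  (forall i, U i (a i)) -> valid (fun i => a i ~~> ex (U i)).
Proof.
move=> Ua; apply: (@valid_gen I (fun=> A)) => /=.
apply: (valid_le (u := fun p : {i : I & A} =>
  a (tag p) ~~> (a (tag p) ~~> tagged p) ~~> tagged p)) => [[i c]/=|].
  apply: imp_mono => //; apply: imp_mono => //; apply: inf_le.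
  by exists (a i).
exact: valid_app.
Qed.

Lemma valid_ex_elim (I : Type) (U : I -> set A) (c : I -> A) :
  valid (fun p : {i : I & {a | U i a}} => sval (tagged p) ~~> c (tag p)) ->
  valid (fun i => ex (U i) ~~> c i).
Proof.
move=> h; apply: (valid_le (u := fun i =>
  (inf [set u ~~> c i | u in U i] ~~> c i) ~~> c i)) => [i|].
  by apply: imp_mono => //; exact: ex_le.
apply: valid_mp (valid_app _ _) _; apply: sep_up h.
apply: le_meet => i; apply: le_inf => _ [a Ua <-].
exact: (meet_le _ (existT _ i (exist _ a Ua))).
Qed.

Record assembly := Assembly {
  carrier :> Type;
  realizer : carrier -> A;
  realizerP : forall x, S (realizer x) }.

Definition tracked (X Y : assembly) (f : X -> Y) : Prop :=
  S (meet (fun x : X => realizer x ~~> realizer (f x))).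

Record asm_hom (X Y : assembly) := AsmHom {
  asm_fun :> X -> Y;
  asm_tracked : tracked asm_fun }.

Lemma asm_homP (X Y : assembly) (f g : asm_hom X Y) :
  (forall x, f x = g x) -> f = g.
Proof.
case: f g => [f hf] [g hg] /= /funext e; subst g.
by rewrite (Prop_irrelevance hf hg).
Qed.

Lemma asm_hom_app (X Y : assembly) (f g : asm_hom X Y) :
  f = g -> forall x, f x = g x.
Proof. by move=> ->. Qed.

Lemma tracked_id (X : assembly) : tracked (fun x : X => x).
Proof. exact: valid_refl. Qed.

Lemma tracked_comp (X Y Z : assembly) (g : asm_hom Y Z) (f : asm_hom X Y) :
  tracked (fun x : X => g (f x)).
Proof.
exact: valid_trans (asm_tracked f) (valid_reindex f (asm_tracked g)).
Qed.

Definition asm_comp (X Y Z : assembly) (g : asm_hom Y Z) (f : asm_hom X Y) :=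
  AsmHom (tracked_comp g f).

Lemma asm_comp1f (X Y : assembly) (f : asm_hom X Y) :
  asm_comp (AsmHom (@tracked_id Y)) f = f.
Proof. exact: asm_homP. Qed.

Lemma asm_compf1 (X Y : assembly) (f : asm_hom X Y) :
  asm_comp f (AsmHom (@tracked_id X)) = f.
Proof. exact: asm_homP. Qed.

Lemma asm_compA (W X Y Z : assembly) (h : asm_hom Y Z) (g : asm_hom X Y)
    (f : asm_hom W X) :
  asm_comp h (asm_comp g f) = asm_comp (asm_comp h g) f.
Proof. exact: asm_homP. Qed.

Definition Asm : category := Category asm_comp1f asm_compf1 asm_compA.

Definition valued_in (M : set A) (X : assembly) : Prop :=
  forall x : X, M (realizer x).

Definition AsmOf (M : set A) : category := full_subcategory (C := Asm) (valued_in M).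

Section FiniteLimitsAsm.
Variables (M : set A) (MS : M `<=` S) (M0 : M !=set0) (Malg : algebraic M).

Lemma AsmOf_terminal : exists T : AsmOf M, is_terminal T.
Proof.
have [m Mm] := M0.
exists (exist (valued_in M) (@Assembly unit (fun=> m) (fun=> MS Mm)) (fun=> Mm)).
move=> [X MX]; have t : tracked (Y := @Assembly unit (fun=> m) (fun=> MS Mm))
    (fun _ : X => tt).
  by apply: valid_weak; exact: sep_valid (MS Mm).
exists (AsmHom t); split=> // f _.
by apply: asm_homP => x /=; case: (asm_fun f x).
Qed.

Lemma AsmOf_pullback (X Y Z : AsmOf M) (f : hom X Z) (g : hom Y Z) :
  exists (P : AsmOf M) (p : hom P X) (q : hom P Y), is_pullback f g p q.
Proof.
case: X Y Z f g => [X MX] [Y MY] [Z MZ] /= f g.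
pose T := {p : X * Y | f p.1 = g p.2}.
pose E (p : T) := conj (realizer (sval p).1) (realizer (sval p).2).
have ME p : M (E p) by apply: Malg; [exact: MX | exact: MY].
pose P : AsmOf M := exist (valued_in M) (@Assembly T E (fun p => MS (ME p))) ME.
have tp : tracked (X := sval P) (fun p : T => (sval p).1) by exact: valid_conj1.
have tq : tracked (X := sval P) (fun p : T => (sval p).2) by exact: valid_conj2.
exists P, (AsmHom tp), (AsmHom tq); split=> [|[W MW] h k e].
  by apply: asm_homP => -[p e] /=.
have e' w : f (asm_fun h w) = g (asm_fun k w).
  by move: e => /(congr1 (fun h => asm_fun h w)).
pose m w : T := exist _ (asm_fun h w, asm_fun k w) (e' w).
have tm : tracked (X := W) (Y := sval P) m.
  by apply: valid_pair; exact: asm_tracked.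
exists (AsmHom tm); split=> [|m' [ph qh]].
  by split; apply: asm_homP.
apply: asm_homP => w /=; apply: sval_inj.
by rewrite /= -ph -qh /=; case: (sval _).
Qed.

Lemma AsmOf_finitely_complete : finitely_complete (AsmOf M).
Proof. by split; [exact: AsmOf_terminal | exact: AsmOf_pullback]. Qed.

End FiniteLimitsAsm.

Section Image.
Variables (X Y : assembly) (f : asm_hom X Y).

Definition fibre (x : X) : set X := [set x' | f x' = f x].

Definition im_carrier : Type := {c : set X | exists x, c = fibre x}.

Definition im_real (c : im_carrier) : A :=
  ex [set realizer x' | x' in sval c].

Lemma im_realP c : S (im_real c).
Proof.
case: c => c [x e]; rewrite /im_real /= e.
apply: (sep_mp (realizerP x)).
apply: (@valid_sep unit
  (fun=> realizer x ~~> ex [set realizer x' | x' in fibre x]) tt).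
by apply: valid_ex_intro => _; exists x.
Qed.

Definition Im : assembly := Assembly im_realP.

Definition im_class (x : X) : Im := exist _ (fibre x) (ex_intro _ x erefl).

Lemma im_class_tracked : tracked im_class.
Proof. by apply: valid_ex_intro => x; exists x. Qed.

Definition im_proj : asm_hom X Im := AsmHom im_class_tracked.

Lemma im_classP x x' : im_class x = im_class x' <-> f x = f x'.
Proof.
split=> [/(congr1 sval)/= e|e]; first by have : fibre x x by []; rewrite e.
by apply: sval_inj; rewrite /= /fibre e.
Qed.

Lemma im_classS (c : Im) : exists x, c = im_class x.
Proof.
by case: c => c [x e]; exists x; apply: sval_inj.
Qed.

Lemma im_incl_ex (c : Im) : exists y, forall x, sval c x -> f x = y.
Proof. by have [x ->] := im_classS c; exists (f x). Qed.

Definition im_incl_fun (c : Im) : Y := sval (cid (im_incl_ex c)).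

Lemma im_incl_class x : im_incl_fun (im_class x) = f x.
Proof. by rewrite /im_incl_fun; case: cid => y /= /(_ x) <-. Qed.

Lemma im_incl_tracked : tracked im_incl_fun.
Proof.
apply: valid_ex_elim.
apply: sep_up (asm_tracked f); apply: le_meet => -[c [a [x cx e]]] /=; rewrite -e.
apply: le_trans (meet_le _ x) _.
by rewrite /im_incl_fun; case: cid => y /= /(_ x cx) <-.
Qed.

Definition im_incl : asm_hom Im Y := AsmHom im_incl_tracked.

Lemma im_factor x : im_incl (im_proj x) = f x.
Proof. exact: im_incl_class. Qed.

End Image.

Section ImageMap.
Variables (X Y X' Y' : assembly) (f : asm_hom X Y) (f' : asm_hom X' Y').
Variables (l : asm_hom X X').
Hypothesis lP : forall x1 x2, f x1 = f x2 -> f' (l x1) = f' (l x2).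

Lemma im_map_ex (c : Im f) :
  exists c' : Im f', forall x, sval c x -> c' = im_class f' (l x).
Proof.
have [x ->] := im_classS c; exists (im_class f' (l x)) => x' /= e.
by apply/im_classP; apply: lP.
Qed.

Definition im_map_fun (c : Im f) : Im f' := sval (cid (im_map_ex c)).

Lemma im_map_funE (c : Im f) x : sval c x ->
  im_map_fun c = im_class f' (l x).
Proof. by rewrite /im_map_fun; case: cid => c' /= + cx; exact. Qed.

Lemma im_map_tracked : tracked im_map_fun.
Proof.
apply: valid_ex_elim; set J := (X in valid (I := X)).
pose x (j : J) : X := s2val (cid2 (svalP (tagged j))).
have cx (j : J) : sval (tag j) (x j).
  exact: (s2valP (cid2 (svalP (tagged j)))).
have ex_ (j : J) : realizer (x j) = sval (tagged j).
  exact: (s2valP' (cid2 (svalP (tagged j)))).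
have h := valid_trans (asm_tracked l)
  (valid_reindex l (im_class_tracked f')).
apply: sep_up (valid_reindex x h); apply: le_meet => j.
apply: le_trans (meet_le _ j) _.
by rewrite ex_ (im_map_funE (cx j)).
Qed.

Definition im_map : asm_hom (Im f) (Im f') := AsmHom im_map_tracked.

Lemma im_mapE x : im_map (im_proj f x) = im_proj f' (l x).
Proof. exact: im_map_funE. Qed.

Lemma im_map_unique (h : asm_hom (Im f) (Im f')) :
  (forall x, h (im_proj f x) = im_proj f' (l x)) -> h = im_map.
Proof.
move=> hE; apply: asm_homP => c; have [x ->] := im_classS c.
exact: etrans (hE x) (esym (im_mapE x)).
Qed.

End ImageMap.

Section CanonicalFunctor.
Variables (M : set A) (MS : M `<=` S) (M0 : M !=set0) (Malg : algebraic M).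

Local Notation lexM := (AsmOf_finitely_complete MS M0 Malg).

Definition asm_arrow (f : arrow_of (AsmOf M)) :
  asm_hom (sval (adom f)) (sval (acod f)) := amap f.

Lemma premor_fun (f f' : arrow_of (AsmOf M)) (l : hom (adom f) (adom f')) :
  reg_premor l -> forall x1 x2, asm_arrow f x1 = asm_arrow f x2 ->
  asm_arrow f' ((l : asm_hom _ _) x1) = asm_arrow f' ((l : asm_hom _ _) x2).
Proof.
have [m Mm] := M0; move=> hl x1 x2 e.
pose a := conj (realizer x1) (realizer x2).
have Ma : M a by apply: Malg; exact: (svalP (adom f)).
pose W : AsmOf M :=
  exist (valued_in M) (@Assembly unit (fun=> a) (fun=> MS Ma)) (fun=> Ma).
have t1 : tracked (X := sval W) (fun=> x1) by exact: valid_conj1.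
have t2 : tracked (X := sval W) (fun=> x2) by exact: valid_conj2.
have e' : amap f \oc (AsmHom t1 : hom W (adom f)) =
          amap f \oc (AsmHom t2 : hom W (adom f)) by apply: asm_homP.
exact: (asm_hom_app (X := sval W) (reg_premor_coeq lexM hl e') tt).
Qed.

Definition U_obj (f : arrow_of (AsmOf M)) : assembly := Im (asm_arrow f).

(* Independent of the chosen representative of [c]; see [U_mapP]. *)
Definition U_map (f f' : arrow_of (AsmOf M)) (c : reg_hom f f') :
    asm_hom (U_obj f) (U_obj f') :=
  im_map (premor_fun (reg_repP c)).

Lemma U_mapP (f f' : arrow_of (AsmOf M)) (c : reg_hom f f')
    (l : hom (adom f) (adom f')) : sval c l ->
  forall x, U_map c (im_proj (asm_arrow f) x) =
    im_proj (asm_arrow f') ((l : asm_hom _ _) x).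
Proof.
rewrite {1}(reg_repE c) => -[_ e] x; rewrite im_mapE; apply/im_classP.
exact: (asm_hom_app (X := sval (adom f)) e x).
Qed.

Lemma U_mapM (f f' f'' : reg_lex lexM) (c' : hom f' f'') (c : hom f f') :
  U_map (c' \oc c) = asm_comp (U_map c') (U_map c).
Proof.
apply/esym/im_map_unique => x.
apply: (etrans (congr1 (U_map c') (im_mapE (premor_fun (reg_repP c)) x))).
apply: (etrans (im_mapE (premor_fun (reg_repP c')) _)).
apply/im_classP/esym.
exact: (asm_hom_app (X := sval (adom f))
  (reg_rep_mk (reg_premorM lexM (reg_repP c') (reg_repP c))) x).
Qed.

Lemma U_map1 (f : reg_lex lexM) :
  U_map (idc f) = AsmHom (@tracked_id (U_obj f)).
Proof.
apply/esym/im_map_unique => x /=; apply/im_classP.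
apply/esym.
exact: (asm_hom_app (X := sval (adom f)) (reg_rep_mk (@reg_premor1 _ f)) x).
Qed.

Definition canonical_functor : functor (reg_lex lexM) Asm :=
  @Functor (reg_lex lexM) Asm U_obj U_map U_map1 U_mapM.

End CanonicalFunctor.

End ImplicativeAlgebra.

(* Main.v *)
Require Import Defs.
From mathcomp Require Import all_boot all_order.
From mathcomp Require Import boolp classical_sets.
Import Order.Theory.
Local Open Scope classical_set_scope.

(** For compact M and h : Im f -> Im f', apply compactness to the family of
    realizers of the domain of f and to the valuation sending x to the set of
    realizers of the points in the class h [x]: the selection it yields comes
    from a tracked choice of representatives, that is, from a preimage of h.
    Conversely, a valuation nu on X with u <= ex nu induces a morphism from the
    image of the identity of (X, u) to the image of the projection to X of the
    assembly of all pairs (x, a) with a in nu x, each realized by a. A preimage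
    of this morphism under the canonical functor is a section of the projection,
    hence a selection. *)

Section Fullness.
Context (d : Order.disp_t) (A : implicativeAlgebra d) (M : set A).
Context (MS : M `<=` separator A) (M0 : M !=set0) (Malg : algebraic M).

Lemma reg_premor_of_fun (f f' : arrow_of (AsmOf M))
    (l : hom (adom f) (adom f')) :
  (forall x1 x2, asm_arrow f x1 = asm_arrow f x2 ->
     asm_arrow f' ((l : asm_hom _ _) x1) =
     asm_arrow f' ((l : asm_hom _ _) x2)) ->
  reg_premor l.
Proof.
move=> hl K p1 p2 [e _]; apply: asm_homP => k.
exact: (hl _ _ (asm_hom_app (X := sval K) e k)).
Qed.

Lemma compact_full : compact M -> full (canonical_functor MS M0 Malg).
Proof.
move=> cM f f' /= h.
pose X := sval (adom f); pose X' := sval (adom f').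
pose hx (x : X) := (h : asm_hom _ _) (im_proj (asm_arrow f) x).
pose nu (x : X) : set A := [set realizer x' | x' in sval (hx x)].
have [|x||b [_ nub ub _]] := cM X (fun x => realizer x) nu.
- exact: (svalP (adom f)).
- split=> [|_ [x' _ <-]]; last exact: (svalP (adom f')).
  have [x' e] := im_classS (hx x).
  by exists (realizer x'), x' => //; rewrite e.
(* In [Im f'] the realizer of [hx x] is [ex (nu x)] by definition, so the required entailment is the
   tracking of a composite. *)
- exact: (tracked_comp (h : asm_hom _ _) (im_proj (asm_arrow f))).
pose l (x : X) : X' := s2val (cid2 (nub x)).
have lh x : sval (hx x) (l x) by exact: (s2valP (cid2 (nub x))).
have lb x : realizer (l x) = b x by exact: (s2valP' (cid2 (nub x))).
have lE x : hx x = im_class (asm_arrow f') (l x).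
  have [x' e] := im_classS (hx x); have := lh x.
  by rewrite e => /= e'; apply/im_classP.
have lt : tracked (X := X) (Y := X') l.
  by apply: sep_up ub; apply: le_meet => x; rewrite lb; exact: meet_le.
have hl : reg_premor (f := f) (f' := f') (AsmHom lt).
  apply: reg_premor_of_fun => x1 x2 e; apply/im_classP.
  rewrite /= -!lE /hx; congr (asm_fun h _); exact/im_classP.
exists (reg_mk hl); apply/esym/im_map_unique => x.
apply: (etrans (lE x)); apply/im_classP.
exact/esym/(asm_hom_app (X := X) (reg_rep_mk hl) x).
Qed.

Lemma full_compact : full (canonical_functor MS M0 Malg) -> compact M.
Proof.
move=> fullU X u nu Mu hnu unu.
have [m Mm] := M0.
pose P : AsmOf M :=
  exist (valued_in M) (@Assembly _ A X u (fun x => MS _ (Mu x))) Mu.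
(* The constant realizer [m] makes every map into [Y] tracked; the projection from [Q] to [P] need
   not be. *)
pose Y : AsmOf M := exist (valued_in M)
  (@Assembly _ A X (fun=> m) (fun=> MS _ Mm)) (fun=> Mm).
pose T := {x : X & {a | nu x a}}.
have MT (p : T) : M (sval (tagged p)).
  exact: ((hnu (tag p)).2 _ (svalP (tagged p))).
pose Q : AsmOf M := exist (valued_in M)
  (@Assembly _ A T (fun p => sval (tagged p)) (fun p => MS _ (MT p))) MT.
have tf' : tracked (X := sval Q) (Y := sval Y) (fun p : T => tag p).
  by apply: valid_weak; exact: sep_valid (MS _ Mm).
pose f : arrow_of (AsmOf M) := ArrowOf (idc P).
pose f' : arrow_of (AsmOf M) := ArrowOf (AsmHom tf' : hom Q Y).
(* An arbitrary point over [x]: its class in [Im f'] is the whole fibre, whatever the choice. *)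
pose q (x : X) : T :=
  existT _ x (exist _ (sval (cid (hnu x).1)) (svalP (cid (hnu x).1))).
pose r (c : U_obj f) : X := sval (cid (im_classS c)).
have rE c x : sval c x -> r c = x.
  by rewrite /r; case: cid => x' /= -> /= e; exact: esym e.
pose h (c : U_obj f) : U_obj f' := im_class (asm_arrow f') (q (r c)).
have th : tracked h.
  apply: valid_ex_elim; set J := (I in valid (I := I)).
  pose x (j : J) : X := s2val (cid2 (svalP (tagged j))).
  have cx (j : J) : sval (tag j) (x j).
    exact: (s2valP (cid2 (svalP (tagged j)))).
  have xE (j : J) : u (x j) = sval (tagged j).
    exact: (s2valP' (cid2 (svalP (tagged j)))).
  apply: sep_up (valid_reindex x unu); apply: le_meet => j.
  apply: le_trans (meet_le _ j) _; rewrite xE /h (rE _ _ (cx j)) /= /im_real /=.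
  (* The realizers in the fibre over [x j] are exactly [nu (x j)], so [unu] tracks [h]. *)
  suff -> : nu (x j) =
      [set sval (tagged x') | x' in fibre (asm_arrow f') (q (x j))] by [].
  apply/seteqP; split=> [a na|_ [[y [a na]] /= e <-]].
    by exists (existT _ (x j) (exist _ a na)).
  by rewrite -[x j]/(asm_fun (asm_arrow f') (q (x j))) -e.
have [g gE] := fullU f f' (AsmHom th).
pose l : asm_hom (sval P) (sval Q) := reg_rep g.
(* Equal classes in [Im f'] have equal first components, which makes [l] a section. *)
have lX x : tag (l x) = x.
  have := im_mapE (premor_fun MS M0 Malg (reg_repP g)) x.
  move: (asm_hom_app gE (im_class (asm_arrow f) x)) => /= -> /im_classP /= <-.
  exact: rE.
exists (fun x => sval (tagged (l x))).
have nul x : nu x (sval (tagged (l x))).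
  by rewrite -{1}(lX x); exact: (svalP (tagged (l x))).
(* By the realizers of [P] and [Q], tracking of [l] is the entailment from [u] to the selection. *)
split=> //; first exact: asm_tracked l.
exact: valid_ex_intro.
Qed.

End Fullness.

Theorem theorem4p2 (d : Order.disp_t) (A : implicativeAlgebra d) (M : set A)
    (MS : M `<=` separator A) (M0 : M !=set0) (Malg : algebraic M) :
  compact M <-> full (canonical_functor MS M0 Malg).
Proof. by split; [exact: compact_full | exact: full_compact]. Qed.
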